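(* Let $D\subset E$ be an extension of dendriform algebras with a linear retraction $\rho:E\to D$, $V:=\ker\rho$, and let $\Omega(D,V)=\Upsilon_1(E)$ be the corresponding dendriform extending structure. Then: (1) the relation $\sim$ is an equivalence relation on the set $\mathcal{D}(D,V)$ of deformation maps of $\Omega(D,V)$; (2) there exists a bijection between the sets $CH^2(D,E):=\mathcal{C}(D,E)/\cong$ and $H^2(D,V):=\mathcal{D}(D,V)/\sim$, given by $$\Delta:CH^2(D,E)\to H^2(D,V),\qquad\overline{B}\mapsto\overline{d},$$ where $d=\Delta_1(B)$, and $\overline{B}$ and $\overline{d}$ denote the equivalence classes of $B$ and $d$ with respect to $\cong$ and $\sim$, respectively. In particular, the index of $D$ in $E$ is computed by the formula $[E:D]=|H^2(D,V)|$.
   Context: The base field is $\mathbf{k}=\mathbb{C}$. A dendriform algebra is a vector space $D$ with bilinear operations $\succ,\prec$ such that for all $x,y,z$: $(x\succ y+x\prec y)\succ z=x\succ(y\succ z)$; $(x\prec y)\prec z=x\prec(y\succ z+y\prec z)$; $(x\succ y)\prec z=x\succ(y\prec z)$. Isomorphisms ($\cong$) are bijective linear maps preserving both operations. ''$D\subset E$ is an extension of dendriform algebras'' means that $(D,\succ,\prec)$ is a subalgebra of the dendriform algebra $(E,\succ_E,\prec_E)$. A linear retraction is a linear map $\rho:E\to D$ with $\rho(a)=a$ for $a\in D$. The dendriform extending structure $\Upsilon_1(E)=\Omega(D,V)=(\triangleright_1,\triangleright_2,\triangleleft_1,\triangleleft_2,\rightharpoonup_1,\rightharpoonup_2,\leftharpoonup_1,\leftharpoonup_2,f_1,f_2,\succ_V,\prec_V)$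 consists of the bilinear maps defined, for $a\in D$, $x,y\in V$, by $a\triangleright_1x:=a\succ_Ex-\rho(a\succ_Ex)$, $x\triangleleft_1a:=x\succ_Ea-\rho(x\succ_Ea)$, $a\leftharpoonup_1x:=\rho(a\succ_Ex)$, $x\rightharpoonup_1a:=\rho(x\succ_Ea)$, $f_1(x,y):=\rho(x\succ_Ey)$, $x\succ_Vy:=x\succ_Ey-\rho(x\succ_Ey)$, and $\triangleright_2,\triangleleft_2,\leftharpoonup_2,\rightharpoonup_2,f_2,\prec_V$ by the same formulas with $\prec_E$ in place of $\succ_E$. A deformation map of $\Omega(D,V)$ is a linear map $d:V\to D$ such that for all $x,y\in V$: $d(x)\succ d(y)-d(x\succ_Vy)=d(d(x)\triangleright_1y+x\triangleleft_1d(y))-d(x)\leftharpoonup_1y-x\rightharpoonup_1d(y)-f_1(x,y)$, $d(x)\prec d(y)-d(x\prec_Vy)=d(d(x)\triangleright_2y+x\triangleleft_2d(y))-d(x)\leftharpoonup_2y-x\rightharpoonup_2d(y)-f_2(x,y)$. $\mathcal{D}(D,V)$ is the set of all deformation maps of $\Omega(D,V)$. Two deformation maps $d,d'$ are equivalent, $d\sim d'$, if there is a linear automorphism $\delta:V\to V$ such that for all $x,y\in V$: $\delta(x)\succ_V\delta(y)-\delta(x\succ_Vy)=\delta(d(x)\triangleright_1y)+\delta(x\triangleleft_1d(y))-d'(\delta(x))\triangleright_1\delta(y)-\delta(x)\triangleleft_1d'(\delta(y))$, $\delta(x)\prec_V\delta(y)-\delta(x\prec_Vy)=\delta(d(x)\triangleright_2y)+\delta(x\triangleleft_2d(y))-d'(\delta(x))\triangleright_2\delta(y)-\delta(x)\triangleleft_2d'(\delta(y))$.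 A $D$ dendriform complement of $E$ is a subalgebra $B$ of the dendriform algebra $E$ with $E=D+B$ and $D\cap B=\{0\}$; $\mathcal{C}(D,E)$ is the set of all of them, and $\cong$ on it means isomorphism of dendriform algebras. The index $[E:D]$ is the cardinality of the set of isomorphism classes of $D$ dendriform complements of $E$. The map $\Delta_1:\mathcal{C}(D,E)\to\mathcal{D}(D,V)$ is $\Delta_1(B):=-\tilde d|_V$, where $\tilde d:E\to D$ is the retraction associated to $B$, i.e. $\tilde d(a+b)=a$ for $a\in D$, $b\in B$. *)

(* Defs.v *)
From HB Require Import structures.
From mathcomp Require Import all_boot all_order all_algebra.
From mathcomp Require Export complex.
From mathcomp Require Export boolp classical_sets functions cardinality reals.

Set Implicit Arguments.
Unset Strict Implicit.
Unset Printing Implicit Defensive.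

Import GRing.Theory.
Local Open Scope ring_scope.
Local Open Scope classical_set_scope.

Reserved Notation "x ≻ y" (at level 40, left associativity).
Reserved Notation "x ≺ y" (at level 40, left associativity).

HB.mixin Record Lmodule_isDendAlgebra (K : fieldType) D of GRing.Lmodule K D := {
  dsucc : D -> D -> D;
  dprec : D -> D -> D;
  dsucc_linearr : forall x : D, linear (dsucc x);
  dsucc_linearl : forall y : D, linear (dsucc^~ y);
  dprec_linearr : forall x : D, linear (dprec x);
  dprec_linearl : forall y : D, linear (dprec^~ y);
  dend_succ : forall x y z : D,
    dsucc (dsucc x y + dprec x y) z = dsucc x (dsucc y z);
  dend_prec : forall x y z : D,
    dprec (dprec x y) z = dprec x (dsucc y z + dprec y z);
  dend_mid : forall x y z : D,
    dprec (dsucc x y) z = dsucc x (dprec y z)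
}.

#[short(type="dendAlgType")]
HB.structure Definition DendAlgebra (K : fieldType) :=
  {D of GRing.Lmodule K D & Lmodule_isDendAlgebra K D}.

Notation "x ≻ y" := (dsucc x y) : ring_scope.
Notation "x ≺ y" := (dprec x y) : ring_scope.

Definition dend_iso (K : fieldType) (A B : dendAlgType K) : Prop :=
  exists f : {linear A -> B},
    [/\ bijective f,
        forall x y : A, f (x ≻ y) = f x ≻ f y
      & forall x y : A, f (x ≺ y) = f x ≺ f y].

Record subDend (K : fieldType) (E : dendAlgType K) := SubDend {
  subDend_pred : E -> bool;
  subDend_submod : submod_closed subDend_pred;
  subDend_succ : {in subDend_pred &, forall x y, x ≻ y \in subDend_pred};
  subDend_prec : {in subDend_pred &, forall x y, x ≺ y \in subDend_pred}
}.

Section SubDendType.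
Variables (K : fieldType) (E : dendAlgType K) (B : subDend E).

HB.instance Definition _ :=
  GRing.isSubmodClosed.Build K E (subDend_pred B) (subDend_submod B).

Inductive subDend_of : Type := InSubDend x & x \in subDend_pred B.

Definition subDend_val (u : subDend_of) : E := let: InSubDend x _ := u in x.

HB.instance Definition _ := [isSub of subDend_of for subDend_val].
HB.instance Definition _ := [Choice of subDend_of by <:].
HB.instance Definition _ := [SubChoice_isSubZmodule of subDend_of by <:].
HB.instance Definition _ := [SubZmodule_isSubLmodule of subDend_of by <:].

Definition sub_succ (u v : subDend_of) : subDend_of :=
  InSubDend (subDend_succ (valP u) (valP v)).
Definition sub_prec (u v : subDend_of) : subDend_of :=
  InSubDend (subDend_prec (valP u) (valP v)).

Fact sub_succ_linearr u : linear (sub_succ u).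
Proof. by move=> a v w; apply: val_inj; rewrite /= dsucc_linearr. Qed.
Fact sub_succ_linearl v : linear (sub_succ^~ v).
Proof. by move=> a u w; apply: val_inj; rewrite /= dsucc_linearl. Qed.
Fact sub_prec_linearr u : linear (sub_prec u).
Proof. by move=> a v w; apply: val_inj; rewrite /= dprec_linearr. Qed.
Fact sub_prec_linearl v : linear (sub_prec^~ v).
Proof. by move=> a u w; apply: val_inj; rewrite /= dprec_linearl. Qed.
Fact sub_dend_succ u v w :
  sub_succ (sub_succ u v + sub_prec u v) w = sub_succ u (sub_succ v w).
Proof. by apply: val_inj; rewrite /= dend_succ. Qed.
Fact sub_dend_prec u v w :
  sub_prec (sub_prec u v) w = sub_prec u (sub_succ v w + sub_prec v w).
Proof. by apply: val_inj; rewrite /= dend_prec. Qed.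
Fact sub_dend_mid u v w :
  sub_prec (sub_succ u v) w = sub_succ u (sub_prec v w).
Proof. by apply: val_inj; rewrite /= dend_mid. Qed.

HB.instance Definition _ := Lmodule_isDendAlgebra.Build K subDend_of
  sub_succ_linearr sub_succ_linearl sub_prec_linearr sub_prec_linearl
  sub_dend_succ sub_dend_prec sub_dend_mid.

End SubDendType.

Coercion subDend_of : subDend >-> Sortclass.

Record retraction (K : fieldType) (E : dendAlgType K) (D : subDend E) :=
  Retraction {
    retr :> {linear E -> D};
    retrK : forall a : D, retr (\val a) = a
  }.

Section Kernel.
Variables (K : fieldType) (E : dendAlgType K) (D : subDend E).
Variable rho : retraction D.

Definition ker_pred : {pred E} := [pred x | rho x == 0].

Fact ker_submod_closed : submod_closed ker_pred.
Proof.
split=> [|a x y]; rewrite !inE ?linear0 // => /eqP x0 /eqP y0.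
by rewrite linearP x0 y0 scaler0 addr0.
Qed.

HB.instance Definition _ :=
  GRing.isSubmodClosed.Build K E ker_pred ker_submod_closed.

Inductive ker_of : Type := InKer x & x \in ker_pred.

Definition ker_val (u : ker_of) : E := let: InKer x _ := u in x.

HB.instance Definition _ := [isSub of ker_of for ker_val].
HB.instance Definition _ := [Choice of ker_of by <:].
HB.instance Definition _ := [SubChoice_isSubZmodule of ker_of by <:].
HB.instance Definition _ := [SubZmodule_isSubLmodule of ker_of by <:].

Fact ker_proj_subproof (x : E) : x - \val (rho x) \in ker_pred.
Proof. by rewrite inE linearB /= retrK subrr. Qed.

Definition ker_proj (x : E) : ker_of := InKer (ker_proj_subproof x).

End Kernel.

(* [tr], [tl], [rh], [lh] stand for the triangles ▷, ◁ and the harpoons ⇀, ↼. *)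
Record ext_datum (D V : Type) := ExtDatum {
  tr1 : D -> V -> V;
  tr2 : D -> V -> V;
  tl1 : V -> D -> V;
  tl2 : V -> D -> V;
  rh1 : V -> D -> D;
  rh2 : V -> D -> D;
  lh1 : D -> V -> D;
  lh2 : D -> V -> D;
  f1 : V -> V -> D;
  f2 : V -> V -> D;
  succV : V -> V -> V;
  precV : V -> V -> V
}.

(* The bilinearity of the twelve maps follows from that of ≻ and ≺ on E. *)
Definition Upsilon1 (K : fieldType) (E : dendAlgType K) (D : subDend E)
    (rho : retraction D) : ext_datum D (ker_of rho) := {|
  tr1 := fun (a : D) (x : ker_of rho) => ker_proj rho (\val a ≻ \val x);
  tr2 := fun (a : D) (x : ker_of rho) => ker_proj rho (\val a ≺ \val x);
  tl1 := fun (x : ker_of rho) (a : D) => ker_proj rho (\val x ≻ \val a);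
  tl2 := fun (x : ker_of rho) (a : D) => ker_proj rho (\val x ≺ \val a);
  rh1 := fun (x : ker_of rho) (a : D) => rho (\val x ≻ \val a);
  rh2 := fun (x : ker_of rho) (a : D) => rho (\val x ≺ \val a);
  lh1 := fun (a : D) (x : ker_of rho) => rho (\val a ≻ \val x);
  lh2 := fun (a : D) (x : ker_of rho) => rho (\val a ≺ \val x);
  f1 := fun x y : ker_of rho => rho (\val x ≻ \val y);
  f2 := fun x y : ker_of rho => rho (\val x ≺ \val y);
  succV := fun x y : ker_of rho => ker_proj rho (\val x ≻ \val y);
  precV := fun x y : ker_of rho => ker_proj rho (\val x ≺ \val y)
|}.

Definition deformation_maps (K : fieldType) (D : dendAlgType K)
    (V : lmodType K) (O : ext_datum D V) : set (V -> D) :=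
  [set d | [/\ linear d,
    forall x y : V,
      d x ≻ d y - d (succV O x y) =
      d (tr1 O (d x) y + tl1 O x (d y))
        - lh1 O (d x) y - rh1 O x (d y) - f1 O x y
  & forall x y : V,
      d x ≺ d y - d (precV O x y) =
      d (tr2 O (d x) y + tl2 O x (d y))
        - lh2 O (d x) y - rh2 O x (d y) - f2 O x y]].

Definition deformation_equiv (K : fieldType) (D : dendAlgType K)
    (V : lmodType K) (O : ext_datum D V) (d d' : V -> D) : Prop :=
  exists delta : {linear V -> V},
  [/\ bijective delta,
    forall x y : V,
      succV O (delta x) (delta y) - delta (succV O x y) =
      delta (tr1 O (d x) y) + delta (tl1 O x (d y))
        - tr1 O (d' (delta x)) (delta y) - tl1 O (delta x) (d' (delta y))
  & forall x y : V,
      precV O (delta x) (delta y) - delta (precV O x y) =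
      delta (tr2 O (d x) y) + delta (tl2 O x (d y))
        - tr2 O (d' (delta x)) (delta y) - tl2 O (delta x) (d' (delta y))].

Section Complements.
Variables (K : fieldType) (E : dendAlgType K) (D : subDend E).

Definition complements : set (subDend E) :=
  [set B : subDend E |
    (forall x : E, exists (a : D) (b : B), x = \val a + \val b) /\
    [set x | x \in subDend_pred D] `&` [set x | x \in subDend_pred B]
      = [set 0]].

Definition compl_iso (B B' : subDend E) : Prop := dend_iso B B'.

(* d~ : E -> D, a + b |-> a. For a complement B, the element a below exists and is unique; the default
   value 0 is irrelevant. *)
Definition compl_retr (B : subDend E) (x : E) : D :=
  xget 0 [set a : D | exists b : B, x = \val a + \val b].

Definition Delta1 (rho : retraction D) (B : subDend E) : ker_of rho -> D :=
  fun x => - compl_retr B (\val x).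

End Complements.

Arguments Delta1 [K E D] rho B _.

Definition equivalence_on (T : Type) (A : set T) (r : T -> T -> Prop) : Prop :=
  [/\ forall x, A x -> r x x,
      forall x y, A x -> A y -> r x y -> r y x
    & forall x y z, A x -> A y -> A z -> r x y -> r y z -> r x z].

Definition eclass (T : Type) (A : set T) (r : T -> T -> Prop) (x : T) : set T :=
  [set y | A y /\ r x y].

Definition quotient_set (T : Type) (A : set T) (r : T -> T -> Prop) :
    set (set T) :=
  [set eclass A r x | x in A].

Section Cohomology.
Variables (K : fieldType) (E : dendAlgType K) (D : subDend E).

Definition CH2 : set (set (subDend E)) :=
  quotient_set (complements D) (@compl_iso K E).

Definition H2 (rho : retraction D) : set (set (ker_of rho -> D)) :=
  quotient_set (deformation_maps (Upsilon1 rho))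
               (deformation_equiv (Upsilon1 rho)).

(* The index [E : D] is the cardinal |CH2|; [index_eq_card D S] is the equality
   of cardinals [E : D] = |S|. *)
Definition index_eq_card (T : Type) (S : set T) : Prop := (CH2 #= S)%card.

End Cohomology.

Arguments H2 [K E D] rho _.

(* Main.v *)
Require Import Defs.
From mathcomp Require Import all_boot all_algebra.
From HB Require Import structures.


(** The retraction splits E as the direct sum of D and V = ker rho, with
    projections rho and p = ker_proj rho.  Complements of D in E as a vector
    space are then exactly the graphs {d x + x | x in V} of the linear maps
    d : V -> D.

    Multiplying two points of the graph of d and separating the D- and
    V-components of the product shows that the two deformation identities say
    that the product lies on the graph again ([deformation_mapsP]).  Hence
    deformation maps are the same thing as complements that are subalgebras:
    [is_graph_deformation], [is_graph_complement] and [deformation_is_graph]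
    pass between the two, and [Delta1_is_graph] identifies the map attached to
    a complement B as Delta1 B.

    The projection p restricts to a linear bijection from the graph of d onto
    V, along which the products of the graph become [graph_mul] on V.  The
    identities defining d ~ d' say that delta is an isomorphism from V with the
    products coming from d to V with those coming from d'
    ([deformation_equivP]).  In this form ~ is visibly an equivalence relation
    ([deformation_equiv_equivalence]), and it corresponds to isomorphism of
    complements ([compl_iso_graph]).  So Delta1 is a surjection that preserves
    and reflects the two relations, and it induces a bijection of the quotients
    ([quotient_set_bij]). *)

Section Theory.

Import GRing.Theory.
Local Open Scope ring_scope.
Local Open Scope classical_set_scope.
Set Implicit Arguments.
Unset Strict Implicit.
Unset Printing Implicit Defensive.

(** * Maps induced on quotients *)

(** A surjection from A to A' under which r is the pullback of r' identifies the
    quotients.  The induced map sends a set C of A to the r'-saturation of its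
    image, which needs no choice of representatives; that r is an equivalence
    follows from the corresponding property of r'. *)
Lemma quotient_set_bij (T T' : Type) (A : set T) (A' : set T')
    (r : T -> T -> Prop) (r' : T' -> T' -> Prop) (f : T -> T') :
  equivalence_on A' r' ->
  (forall x, A x -> A' (f x)) ->
  (forall y, A' y -> exists2 x, A x & f x = y) ->
  (forall x y, A x -> A y -> r x y <-> r' (f x) (f y)) ->
  exists Delta : set T -> set T',
    set_bij (quotient_set A r) (quotient_set A' r') Delta /\
    (forall x, A x -> Delta (eclass A r x) = eclass A' r' (f x)).
Proof.
move=> [refl' sym' tr'] fA f_surj rE.
pose Delta (C : set T) := [set y | A' y /\ exists2 x, C x & r' (f x) y].
have DeltaE x : A x -> Delta (eclass A r x) = eclass A' r' (f x).
  move=> Ax; apply/seteqP; split=> y [A'y].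
    move=> [x' [Ax' /(rE _ _ Ax Ax') rxx'] rx'y]; split=> //.
    by apply: (tr' _ _ _ _ _ _ rxx' rx'y) => //; apply: fA.
  move=> rxy; split=> //; exists x => //; split=> //.
  by apply/rE => //; apply: refl'; apply: fA.
exists Delta; split=> //; split.
- by move=> _ [x Ax <-]; exists (f x); [exact: fA | rewrite DeltaE].
- move=> _ _ /set_mem[x Ax <-] /set_mem[y Ay <-]; rewrite !DeltaE // => e.
  have A'x := fA _ Ax; have A'y := fA _ Ay.
  have [_ rxy] : eclass A' r' (f x) (f y) by rewrite e; split=> //; apply: refl'.
  have ryx := sym' _ _ A'x A'y rxy.
  apply/seteqP; split=> z [Az]; have A'z := fA _ Az.
    move/(rE _ _ Ax Az) => rxz; split=> //.
    by apply/rE => //; apply: (tr' _ _ _ _ _ _ ryx rxz).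
  move/(rE _ _ Ay Az) => ryz; split=> //.
  by apply/rE => //; apply: (tr' _ _ _ _ _ _ rxy ryz).
- move=> _ [y /f_surj[x Ax <-] <-]; exists (eclass A r x); last exact: DeltaE.
  by exists x.
Qed.

(** * The splitting of E, and products of points of a graph *)

Section Graphs.
Variables (K : fieldType) (E : dendAlgType K) (D : subDend E).
Variable rho : retraction D.
Local Notation V := (ker_of rho).
Local Notation p := (ker_proj rho).

Fact ker_proj_linear : linear p.
Proof.
move=> a x y; apply: val_inj => /=.
by rewrite linearP /= scalerBr opprD addrACA.
Qed.
HB.instance Definition _ :=
  GRing.isLinear.Build K E V _ (ker_proj rho) ker_proj_linear.

Lemma retr_ker (x : V) : rho (\val x) = 0.
Proof. by apply/eqP; exact: (valP x). Qed.

Lemma ker_projD (a : D) : p (\val a) = 0.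
Proof. by apply: val_inj; rewrite /= retrK subrr. Qed.

Lemma ker_projK (x : V) : p (\val x) = x.
Proof. by apply: val_inj; rewrite /= retr_ker subr0. Qed.

Lemma retr_addD (a : D) (e : E) : rho (\val a + e) = a + rho e.
Proof. by rewrite linearD /= retrK. Qed.

Lemma ker_proj_addD (a : D) (e : E) : p (\val a + e) = p e.
Proof. by rewrite linearD /= ker_projD add0r. Qed.

Definition graph_pt (d : V -> D) (x : V) : E := \val (d x) + \val x.

Lemma retr_graph_pt d x : rho (graph_pt d x) = d x.
Proof. by rewrite retr_addD retr_ker addr0. Qed.

Lemma ker_proj_graph_pt d x : p (graph_pt d x) = x.
Proof. by rewrite ker_proj_addD ker_projK. Qed.

Lemma retr_ker_proj_inj (e e' : E) : rho e = rho e' -> p e = p e' -> e = e'.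
Proof.
by move=> re /(congr1 val) /=; rewrite re => /addIr.
Qed.

(** The product op of the graph of d, transported to V along the projection p;
    when the graph is a subalgebra this makes V a copy of that subalgebra. *)
Definition graph_mul (op : E -> E -> E) (d : V -> D) (x y : V) : V :=
  p (op (graph_pt d x) (graph_pt d y)).

(* Both dendriform products enter only as bilinear operations of E preserving
   D, so each computation is done once for such an operation op. *)
Section OneProduct.
Variables (op : E -> E -> E) (opD : D -> D -> D).
Hypothesis op_linearr : forall x, linear (op x).
Hypothesis op_linearl : forall y, linear (op^~ y).
Hypothesis op_val : forall a b : D, op (\val a) (\val b) = \val (opD a b).

Lemma op_graph_pt d x y : op (graph_pt d x) (graph_pt d y) =
  \val (opD (d x) (d y)) + op (\val (d x)) (\val y)
  + op (\val x) (\val (d y)) + op (\val x) (\val y).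
Proof.
have opDr x1 y1 z1 : op x1 (y1 + z1) = op x1 y1 + op x1 z1.
  by have := op_linearr x1 1 y1 z1; rewrite !scale1r.
have opDl x1 y1 z1 : op (y1 + z1) x1 = op y1 x1 + op z1 x1.
  by have := op_linearl x1 1 y1 z1; rewrite !scale1r.
by rewrite /graph_pt opDl !opDr op_val addrA.
Qed.

Lemma graph_mulE d x y : graph_mul op d x y =
  p (op (\val (d x)) (\val y)) + p (op (\val x) (\val (d y)))
  + p (op (\val x) (\val y)).
Proof. by rewrite /graph_mul op_graph_pt !linearD /= ker_projD add0r. Qed.

(** The product of two points of the graph of d has D-component
    opD (d x) (d y) plus the three terms under rho, and V-component
    [graph_mul]; expanding d of the latter by linearity, the deformation
    identity becomes the membership of that product in the graph. *)
Lemma deformation_eqP d x y : linear d ->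
  opD (d x) (d y) - d (p (op (\val x) (\val y))) =
    d (p (op (\val (d x)) (\val y)) + p (op (\val x) (\val (d y))))
    - rho (op (\val (d x)) (\val y)) - rho (op (\val x) (\val (d y)))
    - rho (op (\val x) (\val y))
  <-> rho (op (graph_pt d x) (graph_pt d y)) = d (graph_mul op d x y).
Proof.
move=> d_lin.
have dD y1 z1 : d (y1 + z1) = d y1 + d z1.
  by have := d_lin 1 y1 z1; rewrite !scale1r.
rewrite graph_mulE op_graph_pt !linearD /= retrK !dD.
set S := _ + d _; set C := d (p _); set a := opD _ _.
set l := rho _; set r := rho _; set f := rho _.
have -> : a + l + r + f = a + f + r + l.
  by rewrite -!addrA; congr (_ + _); rewrite addrA addrC (addrC l).
have eqE : (a - C == S - l - r - f) = (a + f + r + l == S + C).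
  by rewrite subr_eq eq_sym 3!(addrAC _ _ C) 3!subr_eq eq_sym.
by split=> /eqP; [rewrite eqE | rewrite -eqE] => /eqP.
Qed.

(** By [graph_mulE] the terms of the identity are exactly the three summands of
    each of the two transported products. *)
Lemma deformation_equiv_eqP d d' (delta : {linear V -> V}) x y :
  p (op (\val (delta x)) (\val (delta y))) - delta (p (op (\val x) (\val y))) =
    delta (p (op (\val (d x)) (\val y)))
    + delta (p (op (\val x) (\val (d y))))
    - p (op (\val (d' (delta x))) (\val (delta y)))
    - p (op (\val (delta x)) (\val (d' (delta y))))
  <-> delta (graph_mul op d x y) = graph_mul op d' (delta x) (delta y).
Proof.
rewrite !graph_mulE !linearD /=.
set A := p _; set C := delta _; set S := delta _; set T := delta _.
set S' := p _; set T' := p _.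
rewrite [S' + T' + A]addrC (addrC S') addrA.
have eqE : (A - C == S + T - S' - T') = (S + T + C == A + T' + S').
  by rewrite subr_eq eq_sym 2!(addrAC _ _ C) 2!subr_eq.
by split=> /eqP; [rewrite eqE | rewrite -eqE] => /eqP.
Qed.

End OneProduct.

(** * Deformation maps and their equivalence, read on graphs *)

Lemma deformation_mapsP (d : V -> D) :
  deformation_maps (Upsilon1 rho) d <->
  [/\ linear d,
      forall x y, rho (graph_pt d x ≻ graph_pt d y) = d (graph_mul dsucc d x y)
    & forall x y, rho (graph_pt d x ≺ graph_pt d y) = d (graph_mul dprec d x y)].
Proof.
have eqs (d_lin : linear d) x y := deformation_eqP (opD := @dsucc K D)
  dsucc_linearr dsucc_linearl
  (fun a b : D => erefl (\val a ≻ \val b)) x y d_lin.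
have eqp (d_lin : linear d) x y := deformation_eqP (opD := @dprec K D)
  dprec_linearr dprec_linearl
  (fun a b : D => erefl (\val a ≺ \val b)) x y d_lin.
by split=> -[d_lin ds dp]; split=> // x y; (apply/eqs || apply/eqp) => //;
  (apply: ds || apply: dp).
Qed.

Lemma deformation_equivP (d d' : V -> D) :
  deformation_equiv (Upsilon1 rho) d d' <->
  exists delta : {linear V -> V}, [/\ bijective delta,
    {morph delta : x y / graph_mul dsucc d x y >-> graph_mul dsucc d' x y}
  & {morph delta : x y / graph_mul dprec d x y >-> graph_mul dprec d' x y}].
Proof.
have eqs delta x y := deformation_equiv_eqP (opD := @dsucc K D)
  dsucc_linearr dsucc_linearl
  (fun a b : D => erefl (\val a ≻ \val b)) d d' delta x y.
have eqp delta x y := deformation_equiv_eqP (opD := @dprec K D)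
  dprec_linearr dprec_linearl
  (fun a b : D => erefl (\val a ≺ \val b)) d d' delta x y.
by split=> -[delta [bij ds dp]]; exists delta; split=> // x y;
  (apply/eqs || apply/eqp) => //; (apply: ds || apply: dp).
Qed.

Lemma linear_bundle (U W : lmodType K) (f : U -> W) :
  linear f -> exists g : {linear U -> W}, g =1 f.
Proof.
move=> f_lin; pose m := GRing.isLinear.Build K U W _ f f_lin.
pose g : {linear U -> W} := HB.pack f m.
by exists g.
Qed.

Lemma deformation_equiv_equivalence :
  equivalence_on (deformation_maps (Upsilon1 rho))
                 (deformation_equiv (Upsilon1 rho)).
Proof.
split.
- move=> d _; apply/deformation_equivP.
  by exists idfun; split=> //; exists idfun.
- move=> d d' _ _ /deformation_equivP[delta [[delta' K1 K2] ds dp]].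
  apply/deformation_equivP.
  have [g gE] := linear_bundle (can2_linear K1 K2).
  exists g; split.
  + by exists delta => x; rewrite gE.
  + by move=> x y; rewrite !gE; apply: (can_inj K1); rewrite K2 ds !K2.
  + by move=> x y; rewrite !gE; apply: (can_inj K1); rewrite K2 dp !K2.
- move=> d d' d'' _ _ _ /deformation_equivP[delta [bij ds dp]].
  move=> /deformation_equivP[delta' [bij' ds' dp']]; apply/deformation_equivP.
  exists (delta' \o delta); split; first exact: bij_comp.
  + by move=> x y /=; rewrite ds ds'.
  + by move=> x y /=; rewrite dp dp'.
Qed.

(** * Subalgebras that are graphs *)

(** Since e = rho e + p e, the equation says that e is d x + x for x = p e.  It
    allows B and d to determine each other without choosing decompositions. *)
Definition is_graph (B : subDend E) (d : V -> D) : Prop :=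
  forall e, e \in subDend_pred B <-> rho e = d (p e).

Section OfGraph.
Variables (B : subDend E) (d : V -> D).
Hypothesis Bd : is_graph B d.

Lemma graph_pt_in x : graph_pt d x \in subDend_pred B.
Proof. by apply/Bd; rewrite retr_graph_pt ker_proj_graph_pt. Qed.

(** The inverse of the projection of B to V: B is isomorphic to V with the
    products [graph_mul], and the lemmas below record this isomorphism in both
    directions. *)
Definition graph_lift (x : V) : B := InSubDend (graph_pt_in x).

(** B is a subspace, so it contains a combination of two points of the graph;
    the D-component of that combination is then d of its V-component. *)
Lemma is_graph_linear : linear d.
Proof.
move=> a x y.
have /Bd := valP (a *: graph_lift x + graph_lift y).
by rewrite !linearP /= !retr_graph_pt !ker_proj_graph_pt.
Qed.

Lemma is_graph_deformation : deformation_maps (Upsilon1 rho) d.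
Proof.
apply/deformation_mapsP; split; first exact: is_graph_linear.
- by move=> x y; apply/Bd; exact: (valP (graph_lift x ≻ graph_lift y)).
- by move=> x y; apply/Bd; exact: (valP (graph_lift x ≺ graph_lift y)).
Qed.

Lemma graph_liftK : cancel graph_lift (fun b => p (\val b)).
Proof. by move=> x /=; rewrite ker_proj_graph_pt. Qed.

Lemma ker_proj_graphK : cancel (fun b : B => p (\val b)) graph_lift.
Proof.
move=> b; apply: val_inj; apply: retr_ker_proj_inj => /=.
  by rewrite retr_graph_pt; apply/esym/Bd; exact: (valP b).
exact: ker_proj_graph_pt.
Qed.

Lemma ker_proj_val_linear : linear (fun b : B => p (\val b)).
Proof. by move=> a b c; rewrite !linearP. Qed.

Lemma graph_lift_linear : linear graph_lift.
Proof.
move=> a x y; apply: (can_inj ker_proj_graphK).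
by rewrite ker_proj_val_linear !graph_liftK.
Qed.

Lemma graph_lift_succ x y :
  graph_lift (graph_mul dsucc d x y) = graph_lift x ≻ graph_lift y.
Proof. by rewrite -[RHS]ker_proj_graphK. Qed.

Lemma graph_lift_prec x y :
  graph_lift (graph_mul dprec d x y) = graph_lift x ≺ graph_lift y.
Proof. by rewrite -[RHS]ker_proj_graphK. Qed.

Lemma ker_proj_succ (b c : B) :
  p (\val (b ≻ c)) = graph_mul dsucc d (p (\val b)) (p (\val c)).
Proof.
by apply: (can_inj graph_liftK); rewrite graph_lift_succ !ker_proj_graphK.
Qed.

Lemma ker_proj_prec (b c : B) :
  p (\val (b ≺ c)) = graph_mul dprec d (p (\val b)) (p (\val c)).
Proof.
by apply: (can_inj graph_liftK); rewrite graph_lift_prec !ker_proj_graphK.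
Qed.

(** Subtracting from x the point of the graph above p x leaves an element of D,
    and the only point of the graph above p e = 0, for e in D, is 0. *)
Lemma is_graph_complement : complements D B.
Proof.
split=> [x|].
  exists (rho x - d (p x)), (graph_lift (p x)).
  apply: retr_ker_proj_inj.
    by rewrite retr_addD retr_graph_pt subrK.
  by rewrite ker_proj_addD ker_proj_graph_pt.
apply/seteqP; split=> [e [/= De /Bd]|_ ->]; last first.
  by split; [exact: (valP (0 : D)) | exact: (valP (0 : B))].
pose a : D := InSubDend De; have ea : e = \val a by [].
have d0 : d 0 = 0.
  by have := is_graph_linear (-1) 0 0; rewrite scaler0 addr0 scaleN1r addNr.
by rewrite /= ea ker_projD retrK d0 => ->.
Qed.

Lemma is_graph_uniq d' : is_graph B d' -> d' = d.
Proof.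
move=> Bd'; apply: funext => x.
by have /Bd' := graph_pt_in x; rewrite retr_graph_pt ker_proj_graph_pt.
Qed.

End OfGraph.

(** Isomorphisms of the two complements are conjugated to automorphisms of V by
    the projections of B and B' to V. *)
Lemma compl_iso_graph B B' d d' : is_graph B d -> is_graph B' d' ->
  compl_iso B B' <-> deformation_equiv (Upsilon1 rho) d d'.
Proof.
move=> Bd Bd'; have liftbij := Bijective (graph_liftK _) (ker_proj_graphK _).
have projbij := Bijective (ker_proj_graphK _) (graph_liftK _).
split=> [[f [f_bij fs fp]]|/deformation_equivP[delta [bij ds dp]]].
  have [g gE] : exists g : {linear V -> V},
      g =1 (fun b : B' => p (\val b)) \o (f \o graph_lift Bd).
    apply: linear_bundle => a x y /=.
    by rewrite graph_lift_linear linearP ker_proj_val_linear.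
  apply/deformation_equivP; exists g; split.
  - apply: (eq_bij _ (fsym gE)).
    exact: bij_comp (projbij _ _ Bd') (bij_comp f_bij (liftbij _ _ Bd)).
  - move=> x y; apply: (can_inj (graph_liftK Bd')).
    by rewrite graph_lift_succ !gE /= !ker_proj_graphK graph_lift_succ fs.
  - move=> x y; apply: (can_inj (graph_liftK Bd')).
    by rewrite graph_lift_prec !gE /= !ker_proj_graphK graph_lift_prec fp.
have [g gE] : exists g : {linear B -> B'},
    g =1 graph_lift Bd' \o (delta \o (fun b : B => p (\val b))).
  apply: linear_bundle => a x y /=.
  by rewrite ker_proj_val_linear linearP graph_lift_linear.
exists g; split.
- apply: (eq_bij _ (fsym gE)).
  exact: bij_comp (liftbij _ _ Bd') (bij_comp bij (projbij _ _ Bd)).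
- move=> b c; rewrite !gE.
  have := congr1 (graph_lift Bd' \o delta) (ker_proj_succ Bd b c).
  by rewrite [RHS]/= ds graph_lift_succ.
- move=> b c; rewrite !gE.
  have := congr1 (graph_lift Bd' \o delta) (ker_proj_prec Bd b c).
  by rewrite [RHS]/= dp graph_lift_prec.
Qed.

(** * Complements and deformation maps *)

Lemma deformation_is_graph d :
  deformation_maps (Upsilon1 rho) d -> exists B, is_graph B d.
Proof.
move=> /deformation_mapsP[d_lin ds dp].
pose P (e : E) := rho e == d (p e).
have d0 : d 0 = 0.
  by have := d_lin (-1) 0 0; rewrite scaler0 addr0 scaleN1r addNr.
have Pgraph e : e \in P -> e = graph_pt d (p e).
  move=> /eqP re; apply: retr_ker_proj_inj.
    by rewrite retr_graph_pt.
  by rewrite ker_proj_graph_pt.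
have Psub : submod_closed P.
  split=> [|a x y]; rewrite !unfold_in /P ?linear0 ?d0 //.
  by move=> /eqP xP /eqP yP; rewrite !linearP d_lin xP yP.
have Psucc : {in P &, forall x y, x ≻ y \in P}.
  by move=> x y /Pgraph -> /Pgraph ->; apply/eqP; apply: ds.
have Pprec : {in P &, forall x y, x ≺ y \in P}.
  by move=> x y /Pgraph -> /Pgraph ->; apply/eqP; apply: dp.
by exists (SubDend Psub Psucc Pprec) => e; split=> /eqP.
Qed.

Lemma compl_retrE (B : subDend E) (a : D) (b : B) :
  complements D B -> compl_retr D B (\val a + \val b) = a.
Proof.
move=> [_ DB0]; apply: xget_unique; first by exists b.
move=> a' [b' e].
have e' : \val (a' - a) = \val (b - b') :> E.
  rewrite !linearB /=; apply/eqP; rewrite subr_eq addrAC eq_sym subr_eq.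
  by rewrite addrC e addrC.
have : [set 0 : E] (\val (a' - a)).
  rewrite -DB0; split; first exact: (valP (a' - a)).
  by rewrite e'; exact: (valP (b - b')).
move=> /= a'a0; apply/eqP; rewrite -subr_eq0; apply/eqP; exact: val_inj.
Qed.

(** For b in B the decomposition of the V-component of b along D and B is
    p b = - rho b + b, so Delta1 B sends p b to rho b: B is contained in the
    graph.  Conversely a point e = a + b of the graph has the same V-component
    as b, hence the same D-component, and e = b. *)
Lemma Delta1_is_graph (B : subDend E) :
  complements D B -> is_graph B (Delta1 rho B).
Proof.
move=> DB.
have DeltaE (b : B) : Delta1 rho B (p (\val b)) = rho (\val b).
  rewrite /Delta1 /=.
  have -> : \val b - \val (rho (\val b)) = \val (- rho (\val b)) + \val b.
    by rewrite linearN addrC.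
  by rewrite compl_retrE // opprK.
move=> e; split=> [Be|re]; first by rewrite (DeltaE (InSubDend Be)).
have [/(_ e)[a [b eab]] _] := DB.
have pe : p e = p (\val b) by rewrite eab ker_proj_addD.
rewrite pe DeltaE in re; rewrite (retr_ker_proj_inj re pe); exact: (valP b).
Qed.

End Graphs.
End Theory.

Theorem theorem5p8 (R : realType) (E : dendAlgType R[i]) (D : subDend E)
    (rho : retraction D) :
  equivalence_on (deformation_maps (Upsilon1 rho))
                 (deformation_equiv (Upsilon1 rho)) /\
  (exists Delta : set (subDend E) -> set (ker_of rho -> D),
     set_bij (CH2 D) (H2 rho) Delta /\
     (forall B : subDend E, complements D B ->
        deformation_maps (Upsilon1 rho) (Delta1 rho B) /\
        Delta (eclass (complements D) (@compl_iso _ E) B) =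
        eclass (deformation_maps (Upsilon1 rho))
               (deformation_equiv (Upsilon1 rho)) (Delta1 rho B))) /\
  index_eq_card D (H2 rho).
Proof.
have sim_equiv := deformation_equiv_equivalence rho.
have Delta1_def B (DB : complements D B) :
    deformation_maps (Upsilon1 rho) (Delta1 rho B).
  exact: is_graph_deformation (Delta1_is_graph rho DB).
have [||Delta [Delta_bij DeltaE]] :=
    quotient_set_bij (r := @compl_iso _ E) sim_equiv Delta1_def.
- move=> d /deformation_is_graph[B Bd].
  have DB := is_graph_complement Bd.
  exists B => //; exact (is_graph_uniq Bd (Delta1_is_graph rho DB)).
- by move=> B B' DB DB'; apply: compl_iso_graph; exact: Delta1_is_graph.
split=> //; split; last by apply/card_set_bijP; exists Delta.
by exists Delta; split=> // B DB; split; [exact: Delta1_def | exact: DeltaE].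
Qed.
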